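(* Let $d\ge 2$ be an integer and $p$ an odd prime. For $n\ge0$ let $\alpha_n=\frac{(1/2)_n}{n!}$, where $(x)_n=x(x+1)\cdots(x+n-1)$ (with $(x)_0=1$), and for every integer $s\ge0$ let $$F_{p^s}(z)=\sum_{n=0}^{p^s-1}\alpha_n^d z^n$$ (so $F_1(z)=1$). Let $\epsilon_p=(-1)^{d(p-1)/2}$ and suppose that $F_p(\epsilon_p)$ is a $p$-adic unit. Then $F_{p^s}(\epsilon_p)$ is a $p$-adic unit for every $s\ge 1$, the limit $$f(\epsilon_p)=\lim_{s\to\infty}\frac{F_{p^s}(\epsilon_p)}{F_{p^{s-1}}(\epsilon_p)}$$ exists in $\mathbb{Z}_p$, and $$F_p(\epsilon_p)\equiv f(\epsilon_p)\pmod{p^2}.$$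
   Context: The existence of the limit is a result of Dwork (for any $p$-adic unit $z_0$ with $F_p(z_0)$ a $p$-adic unit, the $F_{p^s}(z_0)$ are $p$-adic units and $F_{p^{s+1}}(z_0)/F_{p^s}(z_0)\equiv F_{p^s}(z_0)/F_{p^{s-1}}(z_0)\pmod{p^s}$ for all $s\ge1$); it is included only to define $f(\epsilon_p)$. Congruences are in $\mathbb{Z}_p$ (the coefficients $\alpha_n$ are $p$-integral rationals). *)

(* Defs.v *)
From HB Require Import structures.
From mathcomp Require Import all_boot all_order all_algebra.
Set Implicit Arguments. Unset Strict Implicit. Unset Printing Implicit Defensive.
Import Order.TTheory GRing.Theory Num.Theory.
Local Open Scope ring_scope.

Definition poch (x : rat) (n : nat) : rat := \prod_(i < n) (x + i%:R).

Definition alpha (n : nat) : rat := poch (1/2) n / (n`!)%:R.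

Definition Ftrunc (d m : nat) (z : rat) : rat :=
  \sum_(n < m) alpha n ^+ d * z ^+ n.

Definition eps (d p : nat) : rat := (-1) ^+ (d * ((p - 1) %/ 2))%N.

(* p-adic valuation of a nonzero rational (value 0 at q = 0, unused) *)
Definition vp (p : nat) (q : rat) : int :=
  (logn p `|numq q|%N)%:Z - (logn p `|denq q|%N)%:Z.

Definition padic_unit (p : nat) (q : rat) : bool := (q != 0) && (vp p q == 0).

Definition pcong (p k : nat) (a b : rat) : bool :=
  (a == b) || ((k%:Z <= vp p (a - b))%R).

Definition Fratio (d p s : nat) (z : rat) : rat :=
  Ftrunc d (p ^ s) z / Ftrunc d (p ^ (s.-1)) z.

(* Main.v *)
(** Put [B n = alpha n ^ d z ^ n] with [z = eps d p].  For a digit [a < p] the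
    ratio [w a b = B (a + p b) / B b] is p-integral and satisfies
    [w a b = w a b' mod p ^ (j + 1)] whenever [b = b' mod p ^ j].  Hence
    [F_{p^s}(z) = (L ^ s 1) 0] for the transfer operator
    [(L g) b = sum_(a < p) w a b g (a + p b)], and [g |-> L g - (L g) 0] sends
    p-adically 1-Lipschitz functions to [p] times such functions.  Splitting off the
    constants [(L g) 0] one at a time gives [F_{p^s} = sum_(l < s) J_l F_{p^(s-1-l)}]
    with [p ^ l | J_l], and Dwork's congruences follow from this recursion.

    Modulo [p ^ 2] it remains to see that [sum_a w a b] does not depend on [b].
    Digits [a > (p - 1) / 2] contribute [0] because [d >= 2].  For the others,
    [w a b] is linear in [b], and its slope changes sign under
    [a |-> (p - 1) / 2 - a]; the choice of [z] makes the slopes cancel. *)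

Require Import Defs.
From HB Require Import structures.
From mathcomp Require Import all_boot all_order all_algebra.
From mathcomp Require Import ring zify.
Import Order.TTheory GRing.Theory Num.Theory.
Local Open Scope ring_scope.
Set Implicit Arguments. Unset Strict Implicit. Unset Printing Implicit Defensive.

(** * Divisibility by powers of p in the p-integral rationals *)

(* [x] belongs to [p ^ k Z_(p)]. *)
Definition pdiv_by (p k : nat) (x : rat) : Prop :=
  exists a : int, exists2 b : nat, ~~ (p %| b)%N &
    x * b%:R = (p ^ k)%:R * a%:~R.

Section PadicDivisibility.
Variable p : nat.
Hypothesis p_pr : prime p.
Local Notation pd := (pdiv_by p).

Lemma ndvd_neq0 n : ~~ (p %| n)%N -> (n%:R : rat) != 0.
Proof. by rewrite pnatr_eq0; apply: contra => /eqP ->. Qed.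

Lemma pd_nat n : pd 0 n%:R.
Proof. by exists n%:Z, 1%N; [rewrite dvdn1; case: p p_pr => [|[]] | rewrite mulr1 mul1r]. Qed.

Lemma pd_dvd k n : (p ^ k %| n)%N -> pd k n%:R.
Proof.
move=> /dvdnP[c ->]; exists c%:Z, 1%N; first by rewrite dvdn1; case: p p_pr => [|[]].
by rewrite mulr1 natrM mulrC.
Qed.

Lemma pd0 k : pd k 0.
Proof. by exists 0, 1%N; [rewrite dvdn1; case: p p_pr => [|[]] | rewrite mul0r mulr0]. Qed.

Lemma pd1 : pd 0 1. Proof. exact: (pd_nat 1). Qed.

Lemma pdD k x y : pd k x -> pd k y -> pd k (x + y).
Proof.
move=> [a [b nb ex]] [a' [b' nb' ey]]; exists (a * b' + a' * b), (b * b')%N.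
  by rewrite Euclid_dvdM // negb_or nb.
rewrite natrM intrD !intrM /= mulrDl mulrA ex mulrDr.
by rewrite [b%:R * b'%:R]mulrC (mulrA y) ey !mulrA.
Qed.

Lemma pdN k x : pd k x -> pd k (- x).
Proof. by move=> [a [b nb ex]]; exists (- a), b => //; rewrite mulNr ex mulrNz mulrN. Qed.

Lemma pdB k x y : pd k x -> pd k y -> pd k (x - y).
Proof. by move=> hx hy; apply/pdD/pdN. Qed.

Lemma pdM j k x y : pd j x -> pd k y -> pd (j + k) (x * y).
Proof.
move=> [a [b nb ex]] [a' [b' nb' ey]]; exists (a * a'), (b * b')%N.
  by rewrite Euclid_dvdM // negb_or nb.
by rewrite natrM mulrACA ex ey expnD natrM intrM; ring.
Qed.

Lemma pd_le j k x : (j <= k)%N -> pd k x -> pd j x.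
Proof.
move=> le [a [b nb ex]]; exists ((p ^ (k - j))%:Z * a), b => //.
by rewrite ex intrM mulrA -pmulrn -natrM -expnD subnKC.
Qed.

Lemma pdMl k x y : pd 0 x -> pd k y -> pd k (x * y).
Proof. exact: pdM. Qed.

Lemma pdMr k x y : pd k x -> pd 0 y -> pd k (x * y).
Proof. by rewrite mulrC => hx hy; apply: pdMl. Qed.

Lemma pd_sum k I (r : seq I) (P : pred I) f :
  (forall i, P i -> pd k (f i)) -> pd k (\sum_(i <- r | P i) f i).
Proof. by move=> h; elim/big_ind: _ => //; [apply: pd0 | move=> ? ?; apply: pdD]. Qed.

Lemma pd_prod I (r : seq I) (P : pred I) f :
  (forall i, P i -> pd 0 (f i)) -> pd 0 (\prod_(i <- r | P i) f i).
Proof. by move=> h; elim/big_ind: _ => //; [apply: pd1 | move=> ? ?; apply: pdMl]. Qed.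

Lemma pdX x n : pd 0 x -> pd 0 (x ^+ n).
Proof. by move=> h; elim: n => [|n IH]; [apply: pd1 | rewrite exprS; apply: pdMl]. Qed.

Lemma pd_invn n : ~~ (p %| n)%N -> pd 0 n%:R^-1.
Proof. by move=> nn; exists 1, n => //; rewrite mulVf ?ndvd_neq0 // mulr1. Qed.

(** Serves to clear denominators: a divisibility may be checked after multiplication by any [y]
    whose inverse is p-integral. *)
Lemma pd_mulr_unit k x y : y != 0 -> pd 0 y^-1 -> pd k (x * y) -> pd k x.
Proof. by move=> y0 yi h; rewrite -(mulfK y0 x); apply: pdMr. Qed.

Lemma pdM_cong k x x' y y' : pd 0 x -> pd 0 y' ->
  pd k (x - x') -> pd k (y - y') -> pd k (x * y - x' * y').
Proof.
move=> hx hy' hxx hyy.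
have -> : x * y - x' * y' = x * (y - y') + (x - x') * y' by ring.
by apply: pdD; [apply: pdMl | apply: pdMr].
Qed.

Lemma pdX_cong k x y n : pd 0 x -> pd 0 y -> pd k (x - y) -> pd k (x ^+ n - y ^+ n).
Proof.
move=> hx hy h; elim: n => [|n IH]; first by rewrite subrr; apply: pd0.
by rewrite !exprS; apply: pdM_cong => //; apply: pdX.
Qed.

Lemma pd_prod_cong k I (r : seq I) (P : pred I) f g :
  (forall i, P i -> [/\ pd 0 (f i), pd 0 (g i) & pd k (f i - g i)]) ->
  pd k (\prod_(i <- r | P i) f i - \prod_(i <- r | P i) g i).
Proof.
move=> h.
(* Integrality of both products is carried through the induction, because multiplying two
   congruences uses it. *)
suff [] : [/\ pd 0 (\prod_(i <- r | P i) f i), pd 0 (\prod_(i <- r | P i) g i) &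
   pd k (\prod_(i <- r | P i) f i - \prod_(i <- r | P i) g i)] by [].
elim/big_ind2: _ => //; first by rewrite subrr; split; [apply: pd1..| apply: pd0].
move=> x y x' y' [hx hy hxy] [hx' hy' hxy'].
by split; [apply: pdMl.. | apply: pdM_cong].
Qed.

Lemma pd_trans k x y z : pd k (x - y) -> pd k (y - z) -> pd k (x - z).
Proof. by move=> /pdD h /h; rewrite addrA subrK. Qed.

Lemma pd_sym k x y : pd k (x - y) -> pd k (y - x).
Proof. by move/pdN; rewrite opprB. Qed.

(** * Valuations and p-adic units in terms of divisibility *)

Lemma logn_absz_denq x : (0 < logn p `|numq x|)%N -> logn p `|denq x| = 0%N.
Proof.
rewrite lognE; case: ifP => [/and3P[_ _ pn] _|//].
rewrite lognE; case: ifP => [/and3P[_ _ pdn]|//].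
have : (p %| gcdn `|numq x| `|denq x|)%N by rewrite dvdn_gcd pn pdn.
have /eqP -> := coprime_num_den x.
by rewrite dvdn1; case: p p_pr => [|[]].
Qed.

Lemma pd_vp k x : x != 0 -> pd k x -> (k%:Z <= vp p x)%R.
Proof.
move=> x0 [a [b nb ex]].
have a0 : a != 0.
  apply: contraNneq x0 => a0; move: ex; rewrite a0 mulr0 => /eqP.
  by rewrite mulf_eq0 (negPf (ndvd_neq0 nb)) orbF.
(* Cross-multiplied over the integers, the identity becomes additive under [logn p], where [b]
   contributes [0]. *)
have e : (numq x * b%:Z = (p ^ k)%:Z * a * denq x).
  have d0 : (denq x)%:~R != 0 :> rat by rewrite intr_eq0 denq_eq0.
  apply: (@intr_inj rat); rewrite !intrM.
  have -> : (numq x)%:~R = x * (denq x)%:~R :> rat.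
    by rewrite -{2}[x]divq_num_den mulfVK.
  by rewrite -!pmulrn mulrAC ex.
have b0 : (0 < b)%N by case: b nb {ex e} => //; rewrite dvdn0.
have := congr1 (fun z : int => logn p `|z|%N) e.
rewrite !abszM !absz_nat !lognM ?muln_gt0 ?expn_gt0 ?absz_gt0 ?numq_eq0 ?denq_eq0
  ?(prime_gt0 p_pr) ?a0 ?b0 //.
have -> : logn p b = 0%N by rewrite lognE p_pr b0 (negPf nb).
by rewrite pfactorK // /vp; lia.
Qed.

Lemma pcong_pd k x y : pd k (x - y) -> pcong p k x y.
Proof.
by move=> h; rewrite /pcong -subr_eq0; case: eqVneq => //= n; apply: pd_vp.
Qed.

Lemma pd_of_denq x : logn p `|denq x| = 0%N -> pd 0 x.
Proof.
move=> l0; exists (numq x), `|denq x|%N.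
  by apply/negP => pdn; move: l0; rewrite lognE p_pr absz_gt0 denq_eq0 pdn.
rewrite mul1r -{1}[x]divq_num_den pmulrn gez0_abs ?ltW ?denq_gt0 //.
by rewrite divfK // intr_eq0 denq_eq0.
Qed.

Lemma padic_unitP x : padic_unit p x <-> pd 0 x /\ ~ pd 1 x.
Proof.
rewrite /padic_unit; split=> [/andP[x0 /eqP v0]|[h0 h1]].
  split; last by move/(pd_vp x0); rewrite v0.
  apply: pd_of_denq; have := @logn_absz_denq x; move: v0; rewrite /vp; lia.
have x0 : x != 0 by apply/eqP => x0; apply: h1; rewrite x0; apply: pd0.
rewrite x0 /= eq_le (pd_vp x0 h0) andbT.
case: leP => // v1; case: h1.
have n0 : (0 < logn p `|numq x|)%N by move: v1; rewrite /vp; lia.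
have : (p %| `|numq x|)%N by move: n0; rewrite lognE; case: ifP => // /and3P[].
rewrite -[(p %| _)%N]/(p %| numq x)%Z => /dvdzP[c ec].
exists c, `|denq x|%N.
  apply/negP => pdn; have := logn_absz_denq n0.
  by rewrite lognE p_pr absz_gt0 denq_eq0 pdn.
rewrite -{1}[x]divq_num_den pmulrn gez0_abs ?ltW ?denq_gt0 //.
by rewrite divfK ?intr_eq0 ?denq_eq0 // ec intrM mulrC.
Qed.

Lemma pd_unitV x : padic_unit p x -> x != 0 /\ pd 0 x^-1.
Proof.
move=> /padic_unitP[[a [b nb ex]] h1].
have x0 : x != 0 by apply/eqP => x0; apply: h1; rewrite x0; apply: pd0.
split=> //.
have pa : ~~ (p %| `|a|)%N.
  apply/negP; rewrite -[(p %| _)%N]/(p %| a)%Z => /dvdzP[c ec]; apply: h1.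
  by exists c, b => //; rewrite ex ec intrM expn0 expn1 mul1r mulrC.
(* Here [x = a / b], so the inverse is [b / a]; the sign of [a] moves to the numerator because
   denominators are naturals. *)
exists (sgz a * b%:Z), `|a|%N => //.
have ex1 : x * b%:R = a%:~R by rewrite ex expn0 mul1r.
have -> : `|a|%N%:R = (sgz a)%:~R * (x * b%:R) :> rat.
  by rewrite ex1 -intrM pmulrn abszEsg.
rewrite expn0 mul1r intrM mulrCA; congr (_ * _).
by rewrite mulKf.
Qed.

Lemma padic_unit_cong x y : padic_unit p x -> pd 1 (x - y) -> padic_unit p y.
Proof.
move=> /padic_unitP[h0 h1] h; apply/padic_unitP; split.
  have -> : y = x - (x - y) by ring.
  by apply: pdB => //; apply: pd_le h.
by move=> hy; apply: h1; rewrite -(subrK y x); apply: pdD.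
Qed.

Lemma padic_unitM x y : padic_unit p x -> padic_unit p y -> padic_unit p (x * y).
Proof.
move=> hx hy; have [x0 hxi] := pd_unitV hx.
move/padic_unitP: hx => [hx _]; move/padic_unitP: hy => [hy hy1].
apply/padic_unitP; split; first exact: pdMl.
by move=> /(pdMl hxi); rewrite mulKf.
Qed.

Lemma padic_unit_divr x y : pd 0 x -> pd 0 y -> padic_unit p (x * y) -> padic_unit p x.
Proof.
move=> hx hy /padic_unitP[_ h]; apply/padic_unitP; split=> // hx1.
by apply: h; apply: pdMr.
Qed.

End PadicDivisibility.

(** * Transfer operators *)

Section TransferOperator.
Variable p : nat.
Hypothesis p_pr : prime p.
Local Notation pd := (pdiv_by p).

(** Strong induction on [s + t]. The recursion is applied to both [F s.+1] and [F t.+1]; the factor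
    [J l] supplies [p ^ l], and the bracket left over supplies the rest by the induction
    hypothesis. *)
Lemma renewal_cross_cong (F J : nat -> rat) :
  (forall s, pd 0 (F s)) -> (forall l, pd l (J l)) ->
  (forall s, F s.+1 = \sum_(l < s.+1) J l * F (s - l)%N) ->
  forall s t, pd (minn s t).+1 (F s.+1 * F t - F s * F t.+1).
Proof.
move=> hF hJ rec s t; have [n] := ubnP (s + t); elim: n s t => // n IH s t le_st.
(* Exchanging [s] and [t] only changes the sign of the cross term. *)
wlog lets : s t le_st / (t <= s)%N => [W|].
  case/orP: (leq_total t s) => le; first exact: W.
  rewrite minnC -[_ - _]opprB [F s * _]mulrC [F s.+1 * _]mulrC.
  by apply: pdN; apply: W => //; rewrite addnC.
rewrite (minn_idPr lets).
(* [T] is the recursion for [F s.+1] cut off at [l <= t], so that it matches that for [F t.+1] term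
   by term; the dropped terms carry [p ^ t.+1]. *)
pose T := \sum_(l < t.+1) J l * F (s - l)%N.
have hT : pd t.+1 (F s.+1 - T).
  rewrite rec /T -(big_mkord xpredT (fun l => J l * F (s - l)%N)).
  rewrite -(big_mkord xpredT (fun l => J l * F (s - l)%N)).
  rewrite (big_cat_nat (n := t.+1)) //= addrAC subrr add0r big_nat.
  apply: pd_sum => // l /andP[lt _]; apply: pdMr => //; exact: pd_le (hJ l).
have -> : F s.+1 * F t - F s * F t.+1 =
    (F s.+1 - T) * F t + (T * F t - F s * F t.+1) by ring.
apply: pdD => //; first exact: pdMr.
rewrite rec /T mulr_suml mulr_sumr -sumrB; apply: pd_sum => // -[l lt] _ /=.
have -> : J l * F (s - l)%N * F t - F s * (J l * F (t - l)%N) =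
  J l * (F (s - l)%N * F t - F s * F (t - l)%N) by ring.
have -> : t.+1 = (l + (t - l).+1)%N by lia.
apply: pdM => //.
(* Telescope [F (s - l) F t - F s F (t - l)] into cross terms of smaller weight. *)
suff H e : (e <= l)%N ->
    pd (t - l).+1 (F (s - e)%N * F (t - l + e)%N - F s * F (t - l)%N).
  by have := H l (leqnn _); rewrite subnK.
elim: e => [|e IHe] le_e; first by rewrite subn0 addn0 subrr; apply: pd0.
apply: pd_trans (IHe (ltnW le_e)) => //; apply: pd_sym => //.
have -> : (s - e = (s - e.+1).+1)%N by lia.
rewrite addnS; apply: pd_le (IH _ _ _) => //; lia.
Qed.

Variables (w : nat -> nat -> rat).
Hypothesis w_int : forall a b, (a < p)%N -> pd 0 (w a b).
Hypothesis w_cong : forall a b b' j, (a < p)%N -> b = b' %[mod p ^ j] ->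
  pd j.+1 (w a b - w a b').

Definition transfer (g : nat -> rat) (b : nat) : rat :=
  \sum_(a < p) w a b * g (a + p * b)%N.
Definition transfer0 (g : nat -> rat) (b : nat) : rat :=
  transfer g b - transfer g 0.
Definition transfer_iter (s : nat) : rat := iter s transfer (fun=> 1) 0%N.
Definition transfer_coef (l : nat) : rat := transfer (iter l transfer0 (fun=> 1)) 0.

Lemma eq_transfer g h : g =1 h -> transfer g =1 transfer h.
Proof. by move=> e b; apply: eq_bigr => a _; rewrite e. Qed.

Lemma eq_iter_transfer s g h : g =1 h -> iter s transfer g =1 iter s transfer h.
Proof. by move=> e; elim: s => [|s IH] //=; apply: eq_transfer. Qed.

Lemma iter_transferD s g h b :
  iter s transfer (fun n => g n + h n) b = iter s transfer g b + iter s transfer h b.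
Proof.
elim: s b => [|s IH] //= b; rewrite (eq_transfer IH).
by rewrite -big_split; apply: eq_bigr => a _; rewrite mulrDr.
Qed.

Lemma iter_transferZ s c g b :
  iter s transfer (fun n => c * g n) b = c * iter s transfer g b.
Proof.
elim: s b => [|s IH] //= b; rewrite (eq_transfer IH).
by rewrite mulr_sumr; apply: eq_bigr => a _; rewrite mulrCA.
Qed.

(** These are [p ^ k] times the p-integral, p-adically 1-Lipschitz functions on the naturals,
    described without dividing by [p ^ k]. *)
Definition plipschitz k (g : nat -> rat) :=
  (forall n, pd k (g n)) /\
  (forall j n n', n = n' %[mod p ^ j] -> pd (j + k) (g n - g n')).

(** The extra factor [p] has two sources: [w a b] varies in [b] by one power of [p] more than [b]
    does, and the argument [a + p * b] of [g] is contracted by [p]. Subtracting the value at [0]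
    turns the bound on differences into a bound on values. *)
Lemma transfer0_lipschitz k g : plipschitz k g -> plipschitz k.+1 (transfer0 g).
Proof.
move=> [g_int g_cong].
have H j b b' : b = b' %[mod p ^ j] -> pd (j + k.+1) (transfer g b - transfer g b').
  move=> e; rewrite -sumrB; apply: pd_sum => // -[a lt] _ /=.
  have -> : w a b * g (a + p * b)%N - w a b' * g (a + p * b')%N =
    w a b * (g (a + p * b)%N - g (a + p * b')%N) +
    (w a b - w a b') * g (a + p * b')%N by ring.
  rewrite addnS; apply: pdD => //.
    apply: pdMl => //; first exact: w_int.
    rewrite -addSn; apply: g_cong.
    by apply/eqP; rewrite eqn_modDl expnS -!muln_modr e.
  rewrite -addSn; apply: pdM => //; exact: w_cong.
(* Any two arguments agree modulo [p ^ 0], so [H] at [j = 0] bounds the values themselves. *)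
split=> [n|j n n' e]; first by apply: (H 0%N); rewrite expn0 !modn1.
by rewrite /transfer0 opprB addrA subrK; apply: H.
Qed.

Lemma transfer_coef_pdiv l : pd l (transfer_coef l).
Proof.
have [h _] : plipschitz l (iter l transfer0 (fun=> 1)).
  elim: l => [|l IH]; last exact: transfer0_lipschitz.
  by split=> [n|j n n' _] /=; [apply: pd1 | rewrite subrr; apply: pd0].
by apply: pd_sum => // -[a lt] _; apply: pdMl => //; apply: w_int.
Qed.

Lemma transfer_iter_int s : pd 0 (transfer_iter s).
Proof.
suff H n : pd 0 (iter s transfer (fun=> 1) n) by apply: H.
elim: s n => [|s IH] n /=; first exact: pd1.
by apply: pd_sum => // -[a lt] _; apply: pdMl => //; apply: w_int.
Qed.

Lemma transfer_renewal s :
  transfer_iter s.+1 = \sum_(l < s.+1) transfer_coef l * transfer_iter (s - l).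
Proof.
pose N l := iter l transfer0 (fun=> 1).
(* After [k] constants have been split off, the remaining iterate acts on [N k]. At [k = s.+1]
   nothing is left to iterate, and [N s.+1] vanishes at [0] by construction. *)
suff H k : (k <= s.+1)%N -> transfer_iter s.+1 =
    \sum_(l < k) transfer_coef l * transfer_iter (s - l) +
    iter (s.+1 - k) transfer (N k) 0%N.
  by rewrite (H s.+1) // subnn /= /N /= /transfer0 subrr addr0.
elim: k => [|k IH] le; first by rewrite big_ord0 add0r.
rewrite (IH (ltnW le)) big_ord_recr /= -addrA; congr (_ + _).
have -> : (s.+1 - k = (s - k).+1)%N by lia.
rewrite subSS iterSr.
have e : transfer (N k) =1 fun n => transfer_coef k * 1 + N k.+1 n.
  by move=> n; rewrite /N /= /transfer0 /transfer_coef mulr1 addrC subrK.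
rewrite (eq_iter_transfer _ e) iter_transferD; congr (_ + _).
by rewrite (iter_transferZ _ _ (fun=> 1)).
Qed.

Lemma transfer_dwork s :
  pd s.+1 (transfer_iter s.+2 * transfer_iter s - transfer_iter s.+1 ^+ 2).
Proof.
have := renewal_cross_cong transfer_iter_int transfer_coef_pdiv transfer_renewal s.+1 s.
by rewrite (minn_idPr (leqnSn s)) expr2.
Qed.

(** Since [transfer_iter 0 = 1], the recursion gives [transfer_iter 1 = J_0] and
    [transfer_iter 2 = J_0 ^ 2 + J_1]. The difference is [J_1], which measures how far the digit sum
    depends on [b]. *)
Lemma transfer_iter2_cong k :
  (forall b, pd k (\sum_(a < p) w a b - \sum_(a < p) w a 0)) ->
  pd k (transfer_iter 2 - transfer_iter 1 ^+ 2).
Proof.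
move=> h; rewrite !transfer_renewal !big_ord_recr !big_ord0 /= !add0r subnn subn0.
have -> : transfer_iter 0 = 1 by [].
rewrite transfer_renewal big_ord_recr big_ord0 /= add0r /=.
have -> : transfer_iter 0 = 1 by [].
rewrite !mulr1 expr2 addrAC subrr add0r; apply: pd_sum => // -[a lt] _ /=.
apply: pdMl => //; first exact: w_int.
have e b : transfer (fun=> 1) b = \sum_(a < p) w a b.
  by apply: eq_bigr => i _; rewrite mulr1.
by rewrite /transfer0 !e.
Qed.

Lemma sum_transfer (B : nat -> rat) : B 0%N = 1 ->
  (forall a b, (a < p)%N -> B (a + p * b)%N = w a b * B b) ->
  forall s, \sum_(n < p ^ s) B n = transfer_iter s.
Proof.
move=> B0 Bw s.
(* A test function [g] is needed for the induction: summing over the lowest digit replaces [g] by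
   [transfer g]. *)
have H (g : nat -> rat) : \sum_(n < p ^ s) B n * g n = iter s transfer g 0%N.
  elim: s g => [|s IH] g; first by rewrite big_ord_recl big_ord0 B0 mul1r addr0.
  rewrite iterSr -IH -(big_mkord xpredT (fun n => B n * g n)) expnSr big_nat_mul.
  rewrite big_mkord; apply: eq_bigr => -[b lt] _ /=.
  rewrite -{1}[(b * p)%N]add0n big_addn mulSn addnK big_mkord /transfer mulr_sumr.
  by apply: eq_bigr => -[a lta] _ /=; rewrite mulnC Bw //; ring.
by rewrite /transfer_iter -H; apply: eq_bigr => n _; rewrite mulr1.
Qed.

End TransferOperator.

(** * The p-free part of alpha *)

Lemma alpha0 : alpha 0 = 1.
Proof. by rewrite /alpha /poch big_ord0 fact0 divr1. Qed.

Lemma alphaS n : alpha n.+1 = alpha n * ((2 * n + 1)%N%:R / (2 * n + 2)%N%:R).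
Proof.
rewrite /alpha /poch big_ord_recr /= factS natrM.
have : (n`!%:R : rat) != 0 by rewrite pnatr_eq0 -lt0n fact_gt0.
move: (n`!%:R : rat) (\prod_(i < n) _) => f x f0.
have h1 : (n.+1%:R : rat) != 0 by rewrite pnatr_eq0.
have h2 : ((2 * n + 2)%N%:R : rat) != 0 by rewrite pnatr_eq0; lia.
move: h1 h2; rewrite !(natrD _ (2 * n)) natrM -[n.+1]addn1 natrD => h1 h2.
by field; rewrite f0 h1 h2.
Qed.

Lemma alphaE n : alpha n * \prod_(i < n) (2 * i + 2)%N%:R = \prod_(i < n) (2 * i + 1)%N%:R.
Proof.
elim: n => [|n IH]; first by rewrite !big_ord0 alpha0 mulr1.
rewrite !big_ord_recr /= -IH alphaS mulrACA divfK //.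
by rewrite pnatr_eq0; lia.
Qed.

Section PrimeToPPart.
Variable p : nat.
Hypothesis p_pr : prime p.
Hypothesis p_odd : odd p.
Local Notation pd := (pdiv_by p).
Let m := p./2.

Lemma p_half : p = (2 * m + 1)%N.
Proof. by rewrite /m -[LHS]odd_double_half p_odd; lia. Qed.

Lemma m_gt0 : (0 < m)%N.
Proof. have := prime_gt1 p_pr; have := p_half; lia. Qed.

Lemma dvd_odd_term a b : (a < p)%N -> (p %| 2 * (a + p * b) + 1)%N = (a == m).
Proof.
move=> lt; have hp := p_half.
have -> : (2 * (a + p * b) + 1 = (2 * b) * p + (2 * a + 1))%N by lia.
rewrite dvdn_addr ?dvdn_mull //; apply/idP/eqP => [/dvdnP[[|[|c]] e]|->].
- by lia.
- by lia.
- by nia.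
- by rewrite -hp.
Qed.

Lemma dvd_even_term a b : (a < p)%N -> (p %| 2 * (a + p * b) + 2)%N = (a == 2 * m)%N.
Proof.
move=> lt; have hp := p_half.
have -> : (2 * (a + p * b) + 2 = (2 * b) * p + 2 * (a + 1))%N by lia.
rewrite (dvdn_addr _ (dvdn_mull _ (dvdnn p))) Gauss_dvdr ?coprimen2 //.
apply/idP/eqP => [/dvdn_leq|->]; first by lia.
by rewrite -hp.
Qed.

(** A multiple of [p] is replaced by [1], not by its prime-to-[p] part, as in Morita's p-adic Gamma
    function. Products of such factors are then periodic modulo powers of [p]. *)
Definition prime_to n := if (p %| n)%N then 1%N else n.

Lemma prime_to_ndvd n : ~~ (p %| prime_to n)%N.
Proof. by rewrite /prime_to; case: ifP => [_|->] //; rewrite dvdn1; case: p p_pr => [|[]]. Qed.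

Lemma prime_to_id n : ~~ (p %| n)%N -> prime_to n = n.
Proof. by rewrite /prime_to => /negPf ->. Qed.

Lemma prime_to1 n : (p %| n)%N -> prime_to n = 1%N.
Proof. by rewrite /prime_to => ->. Qed.

Lemma prime_to_neq0 n : ((prime_to n)%:R : rat) != 0.
Proof. exact: ndvd_neq0 (prime_to_ndvd n). Qed.

Lemma pd_nat_cong k x y : x = y %[mod p ^ k] -> pd k (x%:R - y%:R).
Proof.
wlog le : x y / (y <= x)%N => [W e|/eqP].
  by case/orP: (leq_total y x) => le; [|apply: pd_sym => //]; apply: W.
by rewrite eqn_mod_dvd // -natrB // => h; apply: pd_dvd.
Qed.

Lemma prime_to_cong j x y : x = y %[mod p ^ j.+1] ->
  pd j.+1 ((prime_to x)%:R - (prime_to y)%:R).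
Proof.
move=> e; have e1 : (p %| x)%N = (p %| y)%N.
  rewrite /dvdn -(@modn_dvdm (p ^ j.+1)) ?dvdn_exp // e modn_dvdm //.
  by rewrite dvdn_exp.
rewrite /prime_to e1; case: ifP => _; first by rewrite subrr; apply: pd0.
exact: pd_nat_cong.
Qed.

Definition gfactor i : rat := (prime_to (2 * i + 1))%:R / (prime_to (2 * i + 2))%:R.
Definition gprod n : rat := \prod_(i < n) gfactor i.

Lemma gprodS n : gprod n.+1 = gprod n * gfactor n.
Proof. by rewrite /gprod big_ord_recr. Qed.

Lemma gprodD n k : gprod (n + k) = gprod n * \prod_(i < k) gfactor (n + i).
Proof. by rewrite /gprod big_split_ord. Qed.

Lemma pd_gprod n : pd 0 (gprod n).
Proof.
apply: pd_prod => // i _; apply: pdMl => //; first exact: pd_nat.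
exact/pd_invn/prime_to_ndvd.
Qed.

(** In a block of [p] indices the only multiples of [p] are the odd factor at [a = m] and the even
    factor at [a = 2 m = p - 1]. *)
Lemma gfactor_digit a b : (a < p)%N ->
  (2 * (a + p * b) + 1)%N%:R / (2 * (a + p * b) + 2)%N%:R
    * (if a == (2 * m)%N then (p * (2 * b + 2))%N%:R else 1) =
  gfactor (a + p * b) * (if a == m then (p * (2 * b + 1))%N%:R else 1).
Proof.
move=> lt; have hp := p_half; have m0 := m_gt0.
rewrite /gfactor /prime_to dvd_odd_term // dvd_even_term //.
have d0 : ((2 * (a + p * b) + 2)%N%:R : rat) != 0 by rewrite pnatr_eq0; lia.
case: (eqVneq a m) => [am|_].
  have /negPf -> : a != (2 * m)%N by apply/eqP; lia.
  have -> : (p * (2 * b + 1) = 2 * (a + p * b) + 1)%N by lia.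
  by rewrite mulr1 mulrAC mul1r.
case: eqVneq => [am|_]; last by [].
have -> : (p * (2 * b + 2) = 2 * (a + p * b) + 2)%N by lia.
by rewrite mulfVK // divr1 mulr1.
Qed.

(** The endpoint [a = p] is included on purpose: there the even factor [p (2 b + 2)] has entered,
    and the equation becomes the base case for the block of [b.+1]. *)
Lemma alpha_digit_le b : alpha (p * b) = gprod (p * b) * alpha b ->
  forall a, (a <= p)%N ->
  alpha (a + p * b) * (if a == p then (p * (2 * b + 2))%N%:R else 1) =
  gprod (a + p * b) * (if (m < a)%N then (p * (2 * b + 1))%N%:R else 1) * alpha b.
Proof.
move=> base; have hp := p_half; have m0 := m_gt0.
elim=> [|a IH] le.
  by rewrite add0n base !mulr1; case: eqP => [|_]; [lia | rewrite mulr1].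
have /negPf ap : a != p by apply/eqP; lia.
move: (IH (ltnW le)); rewrite ap mulr1 => {}IH.
rewrite addSn alphaS gprodS IH.
have -> : (a.+1 == p) = (a == 2 * m)%N by apply/eqP/eqP; lia.
have -> : (if (m < a.+1)%N then (p * (2 * b + 1))%N%:R else 1) =
  (if a == m then (p * (2 * b + 1))%N%:R else 1) *
  (if (m < a)%N then (p * (2 * b + 1))%N%:R else 1) :> rat.
  case: (ltngtP a m) => am; rewrite ?mulr1 ?mul1r //.
  - by rewrite ltnS leqNgt am.
  - by rewrite ltnS ltnW.
  - by rewrite am ltnS leqnn.
by rewrite -[LHS]mulrA (gfactor_digit b le); ring.
Qed.

Lemma alpha_digit_mul b : alpha (p * b) = gprod (p * b) * alpha b.
Proof.
have hp := p_half; have m0 := m_gt0.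
elim: b => [|b IH]; first by rewrite muln0 alpha0 /gprod big_ord0 mulr1.
have := alpha_digit_le IH (leqnn p); rewrite eqxx (_ : (m < p)%N); last by lia.
rewrite -mulnS alphaS !natrM => e.
have p0 : (p%:R : rat) != 0 by rewrite pnatr_eq0; lia.
have b0 : ((2 * b + 2)%N%:R : rat) != 0 by rewrite pnatr_eq0; lia.
apply: (mulIf b0); apply: (mulIf p0); rewrite !mulrA mulfVK //.
transitivity (alpha (p * b.+1) * (p%:R * (2 * b + 2)%N%:R)); first by ring.
by rewrite e /alpha; ring.
Qed.

Lemma alpha_digit a b : (a < p)%N ->
  alpha (a + p * b) =
  gprod (a + p * b) * (if (m < a)%N then (p * (2 * b + 1))%N%:R else 1) * alpha b.
Proof.
move=> lt; rewrite -(alpha_digit_le (alpha_digit_mul b) (ltnW lt)).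
by rewrite (ltn_eqF lt) mulr1.
Qed.

(** * Congruences for the p-free products modulo powers of [p] *)

(** Moving the window by one place replaces the unit [f n] by [f (n + M)], which is congruent to
    it. *)
Lemma window_shift (f : nat -> rat) k M n :
  (forall i, [/\ f i != 0, pd 0 (f i), pd 0 (f i)^-1 & pd k (f (i + M)%N - f i)]) ->
  pd k (\prod_(i < M) f (n + i)%N - \prod_(i < M) f i).
Proof.
move=> hf; elim: n => [|n IH].
  by under eq_bigr do rewrite add0n; rewrite subrr; apply: pd0.
apply: pd_trans IH => //; have [f0 fi fv fM] := hf n.
apply: pd_mulr_unit f0 fv _ => //.
have e : \prod_(i < M) f (n.+1 + i)%N * f n = \prod_(i < M) f (n + i)%N * f (n + M)%N.
  rewrite -(big_ord_recr M (fun i => f (n + i)%N)) big_ord_recl /= addn0 mulrC.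
  by congr (_ * _); apply: eq_bigr => i _; rewrite addSnnS.
rewrite mulrBl e -mulrBr; apply: pdMl => //.
by apply: pd_prod => // i _; have [] := hf (n + i)%N.
Qed.

(** Over a full period the odd and the even factors run through the same residues modulo the odd
    number [p ^ j.+1], so their quotient is congruent to [1]. *)
Lemma gprod_period j n : pd j.+1 (gprod (n + p ^ j.+1) - gprod n).
Proof.
pose M := (p ^ j.+1)%N; pose h := M./2.
have hM : M = (2 * h + 1)%N.
  by rewrite /h -[LHS]odd_double_half oddX p_odd orbT; lia.
pose o i : rat := (prime_to (2 * i + 1))%:R.
pose e i : rat := (prime_to (2 * i + 2))%:R.
have Ho i : [/\ o i != 0, pd 0 (o i), pd 0 (o i)^-1 & pd j.+1 (o (i + M)%N - o i)].
  split; first exact: prime_to_neq0.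
  - exact: pd_nat.
  - exact/pd_invn/prime_to_ndvd.
  apply: prime_to_cong; rewrite -/M.
  by rewrite mulnDr addnAC addnC modnMDl.
have He i : [/\ e i != 0, pd 0 (e i), pd 0 (e i)^-1 & pd j.+1 (e (i + M)%N - e i)].
  split; first exact: prime_to_neq0.
  - exact: pd_nat.
  - exact/pd_invn/prime_to_ndvd.
  apply: prime_to_cong; rewrite -/M.
  by rewrite mulnDr addnAC addnC modnMDl.
(* [2 i + 1 = 2 (h + i) + 2 mod M]: odd factors are shifted even factors. *)
have Hoe : pd j.+1 (\prod_(i < M) o i - \prod_(i < M) e (h + i)%N).
  apply: pd_prod_cong => // -[i lt] _; split; [exact: pd_nat..|].
  apply: prime_to_cong => /=; rewrite -/M.
  have -> : (2 * (h + i) + 2 = 1 * M + (2 * i + 1))%N.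
    by clearbody M; move: hM; clearbody h; clear; lia.
  by rewrite modnMDl.
have H : pd j.+1 (\prod_(i < M) o (n + i)%N - \prod_(i < M) e (n + i)%N).
  apply: (pd_trans p_pr (window_shift n Ho)).
  apply: (pd_trans p_pr Hoe); apply: (pd_trans p_pr (window_shift h He)).
  exact: (pd_sym (window_shift n He)).
rewrite gprodD prodf_div.
have V0 : \prod_(i < M) e (n + i)%N != 0.
  by apply/prodf_neq0 => i _; have [] := He (n + i)%N.
have -> : forall x y z : rat, z != 0 -> x * (y / z) - x = x * ((y - z) / z).
  by move=> x y z z0; field.
  apply: pdMl => //; first exact: pd_gprod.
  apply: pdMr => //; rewrite -prodfV; apply: pd_prod => // i _.
  by have [] := He (n + i)%N.
exact: V0.
Qed.

Lemma gprod_cong j n n' : n = n' %[mod p ^ j.+1] -> pd j.+1 (gprod n - gprod n').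
Proof.
wlog le : n n' / (n' <= n)%N => [W e|/eqP].
  by case/orP: (leq_total n' n) => le; [|apply: pd_sym => //]; apply: W.
rewrite eqn_mod_dvd // => /dvdnP[c e].
have -> : n = (n' + c * p ^ j.+1)%N by lia.
elim: {le e} c => [|c IH]; first by rewrite addn0 subrr; apply: pd0.
rewrite mulSnr addnA; apply: pd_trans IH => //; exact: gprod_period.
Qed.

End PrimeToPPart.

(** * First-order expansion modulo p^2 *)

Section FirstOrder.
Variable p : nat.
Hypothesis p_pr : prime p.
Hypothesis p_odd : odd p.
Local Notation pd := (pdiv_by p).
Local Notation m := (p./2).
Local Notation G := (gprod p).
Local Notation gf := (gfactor p).

Lemma pd_p : pd 1 p%:R.
Proof. by apply: pd_dvd => //; rewrite expn1. Qed.

Lemma pd_p2 : pd 2 (p%:R ^+ 2).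
Proof. by rewrite -natrX; apply: pd_dvd. Qed.

Lemma ndvd_small n q : (0 < n < p)%N -> ~~ (p %| n + p * q)%N.
Proof.
by case/andP=> n0 np; rewrite dvdn_addl ?dvdn_mulr // gtnNdvd.
Qed.

(* [q] stands for twice the higher digits, so that shifts by 1/2 stay in [nat]:
   [gprod (a + p * b) / gprod (p * b) = psi a (2 * b)], and the factor omitted at the
   middle digit makes [psi m (2 * b + 1)] appear in [gprod_step]. *)
Definition psi a q : rat :=
  \prod_(r < a) ((2 * r + 1 + p * q)%N%:R / (2 * r + 2 + p * q)%N%:R).

Lemma psiS a q :
  psi a.+1 q = psi a q * ((2 * a + 1 + p * q)%N%:R / (2 * a + 2 + p * q)%N%:R).
Proof. by rewrite /psi big_ord_recr. Qed.

(** The logarithmic derivative of [psi a] at [0], in the variable [p * q]. *)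
Definition hdiff a : rat :=
  \sum_(r < a) ((2 * r + 1)%N%:R^-1 - (2 * r + 2)%N%:R^-1).

Lemma pd_hdiff a : (a <= m)%N -> pd 0 (hdiff a).
Proof.
move=> le; have hp := p_half p_pr p_odd; apply: pd_sum => // -[r lt] _ /=.
by apply: pdB => //; apply: pd_invn; rewrite gtnNdvd //; lia.
Qed.

(** Strong induction: [alpha_digit] strips the lowest base-[p] digit at the cost of p-integral
    factors. *)
Lemma pd_alpha n : pd 0 (alpha n).
Proof.
have [k] := ubnP n; elim: k n => // k IH n le.
have p1 := prime_gt1 p_pr.
case: (posnP n) => [->|n0]; first by rewrite alpha0; apply: pd1.
rewrite (divn_eq n p) addnC [(_ * p)%N]mulnC alpha_digit ?ltn_mod ?prime_gt0 //.
apply: pdMl => //; last by apply: IH; have := ltn_Pdiv p1 n0; lia.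
apply: pdMl => //; first exact: pd_gprod.
by case: ifP => _; [apply: pd_nat | apply: pd1].
Qed.

Lemma psi_unit a q : (a <= m)%N -> psi a q != 0 /\ pd 0 (psi a q)^-1.
Proof.
move=> le; have hp := p_half p_pr p_odd.
have h r i : (r < a)%N -> (0 < i <= 2)%N -> ~~ (p %| 2 * r + i + p * q)%N.
  by move=> lt hi; apply: ndvd_small; lia.
split.
  apply/prodf_neq0 => -[r lt] _ /=.
  by rewrite mulf_neq0 ?invr_eq0 //; apply/(@ndvd_neq0 p)/h.
rewrite /psi -prodfV; apply: pd_prod => // -[r lt] _ /=.
by rewrite invf_div; apply: pdMl => //; [apply: pd_nat | apply/pd_invn/h].
Qed.

Lemma psi_first_order a q : (a <= m)%N ->
  pd 2 (psi a q - alpha a * (1 + p%:R * q%:R * hdiff a)).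
Proof.
have hp := p_half p_pr p_odd.
elim: a => [|a IH] le.
  by rewrite /psi /hdiff !big_ord0 alpha0 mulr0 addr0 mulr1 subrr; apply: pd0.
have {}IH := IH (ltnW le).
have nD : ~~ (p %| 2 * a + 2 + p * q)%N by apply: ndvd_small; lia.
have nX : ~~ (p %| 2 * a + 1)%N by rewrite gtnNdvd //; lia.
have nY : ~~ (p %| 2 * a + 2)%N by rewrite gtnNdvd //; lia.
apply: (pd_mulr_unit p_pr (ndvd_neq0 nD) (pd_invn nD)).
have hv := pd_hdiff (ltnW le); have ha := pd_alpha a.
rewrite psiS alphaS /hdiff big_ord_recr /= -/(hdiff a).
rewrite mulrBl -(mulrA (psi a q)) (divfK (ndvd_neq0 nD)).
have X0 := ndvd_neq0 nX; have Y0 := ndvd_neq0 nY.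
have hX := pd_invn nX; have hY := pd_invn nY.
rewrite (natrD _ (2 * a + 1)) (natrD _ (2 * a + 2)) (natrM _ p).
set X := (2 * a + 1)%N%:R in X0 hX *; set Y := (2 * a + 2)%N%:R in Y0 hY *.
set v := hdiff a in IH hv *; set f := psi a q in IH *.
set c := alpha a in IH ha *.
have hXi : pd 0 X by apply: pd_nat.
(* With the unit denominator cleared, the first-order terms cancel, leaving the inductive error and
   an explicit multiple of [p ^ 2]. *)
clearbody X Y; have -> : f * (X + p%:R * q%:R)
  - c * (X / Y) * (1 + p%:R * q%:R * (v + (X^-1 - Y^-1))) * (Y + p%:R * q%:R) =
  (f - c * (1 + p%:R * q%:R * v)) * (X + p%:R * q%:R) +
  p%:R ^+ 2 * (q%:R ^+ 2 * (c * (v - X * (v + X^-1 - Y^-1) * Y^-1))).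
  by field; rewrite X0 Y0.
have hq : pd 0 q%:R by apply: pd_nat.
have hpn : pd 0 p%:R by apply: pd_nat.
apply: pdD => //.
  by apply: pdMr => //; apply: pdD => //; apply: pdMl.
apply: pdMr => //; first exact: pd_p2.
apply: pdMl => //; first exact: pdX.
apply: pdMl => //; apply: pdB => //; apply: pdMl => //.
by apply: pdMl => //; apply: pdB => //; apply: pdD.
Qed.

Lemma gprod_psi a b : (a <= m)%N -> G (a + p * b) = G (p * b) * psi a (2 * b).
Proof.
move=> le; have hp := p_half p_pr p_odd.
rewrite addnC gprodD; congr (_ * _); apply: eq_bigr => -[r lt] _ /=.
rewrite /gf (addnC (p * b)).
have -> : (2 * (r + p * b) + 1 = 2 * r + 1 + p * (2 * b))%N by lia.
have -> : (2 * (r + p * b) + 2 = 2 * r + 2 + p * (2 * b))%N by lia.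
by rewrite !prime_to_id //; apply: ndvd_small; lia.
Qed.

(** From the middle digit on, the factors are [p (2 b + 1) + 2 j] over [p (2 b + 1) + 2 j + 1],
    which are those of [psi] at [2 b + 1] turned upside down. The factor with [prime_to] is the one
    uncancelled denominator; at [k = m] it becomes [1]. *)
Lemma gprod_upper_half b k : (k <= m)%N ->
  (\prod_(j < k.+1) gf (p * b + m + j)%N) *
    (prime_to p (2 * k + 1 + p * (2 * b + 1)))%:R * psi k (2 * b + 1) = 1.
Proof.
have hp := p_half p_pr p_odd; have m0 := m_gt0 p_pr p_odd.
elim: k => [|k IH] le.
  rewrite big_ord_recr big_ord0 /psi big_ord0 /= mul1r mulr1 addn0 /gfactor.
  have -> : (2 * (p * b + m) + 1 = p * (2 * b + 1))%N by lia.
  have -> : (2 * (p * b + m) + 2 = 2 * 0 + 1 + p * (2 * b + 1))%N by lia.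
  by rewrite prime_to1 ?dvdn_mulr // mul1r mulVf // prime_to_neq0.
rewrite -[RHS](IH (ltnW le)) big_ord_recr /= psiS {2}/gfactor.
have -> : (2 * (p * b + m + k.+1) + 1 = 2 * k + 2 + p * (2 * b + 1))%N by lia.
have -> : (2 * (p * b + m + k.+1) + 2 = 2 * k.+1 + 1 + p * (2 * b + 1))%N by lia.
have n2 : ~~ (p %| 2 * k + 2 + p * (2 * b + 1))%N by apply: ndvd_small; lia.
have n1 : ~~ (p %| 2 * k + 1 + p * (2 * b + 1))%N by apply: ndvd_small; lia.
rewrite (prime_to_id n2) (prime_to_id n1).
have h2 := ndvd_neq0 n2; have := prime_to_neq0 p_pr (2 * k.+1 + 1 + p * (2 * b + 1)).
move: h2; move: (prime_to p _)%:R (2 * k + 2 + _)%N%:R => y x.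
by move=> x0 y0; field; rewrite x0 y0.
Qed.

Lemma gprod_step b : G (p * b.+1) * psi m (2 * b + 1) = G (p * b) * psi m (2 * b).
Proof.
have hp := p_half p_pr p_odd.
have := gprod_upper_half b (leqnn m); rewrite prime_to1; last first.
  have -> : (2 * m + 1 + p * (2 * b + 1) = p * (2 * b + 2))%N by lia.
  by rewrite dvdn_mulr.
rewrite mulr1 => e.
have -> : (p * b.+1 = (m + p * b) + m.+1)%N by lia.
rewrite gprodD gprod_psi // [(m + p * b)%N]addnC.
by rewrite -mulrA e mulr1.
Qed.

(** By [gprod_step], passing from [b] to [b.+1] multiplies by [psi m (2 b) / psi m (2 b + 1)], which
    is [1 - p * hdiff m] to first order. *)
Lemma gprod_mulp b : pd 2 (G (p * b) - (1 - p%:R * b%:R * hdiff m)).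
Proof.
elim: b => [|b IH].
  by rewrite muln0 /gprod big_ord0 mulr0 mul0r subr0 subrr; apply: pd0.
have [u0 uV] := psi_unit (2 * b + 1) (leqnn m).
apply: (pd_mulr_unit p_pr u0 uV); rewrite mulrBl gprod_step.
have h0 := psi_first_order (2 * b) (leqnn m).
have h1 := psi_first_order (2 * b + 1) (leqnn m).
have hv := pd_hdiff (leqnn m); have ha := pd_alpha m.
have hg := pd_gprod p_pr (p * b).
have hpn : pd 0 p%:R by apply: pd_nat.
have nat_b : pd 0 b%:R by apply: pd_nat.
have nat_b1 : pd 0 b.+1%:R by apply: pd_nat.
have nat_2b : pd 0 (2 * b)%N%:R by apply: pd_nat.
set v := hdiff m in h0 h1 IH hv *; set c := alpha m in h0 h1 ha.
apply: (pd_trans p_pr (y := (1 - p%:R * b%:R * v) * (c * (1 + p%:R * (2 * b)%N%:R * v)))).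
  apply: pdM_cong => //; apply: pdMl => //; apply: pdD => //; first exact: pd1.
  by apply: pdMl => //; apply: pdMl.
(* The shifts of [b] to [b.+1] and of [2 b] to [2 b + 1] change the first-order terms by [- p v] and
   [+ p v], so only a multiple of [p ^ 2] remains. *)
apply: (pd_trans p_pr
  (y := (1 - p%:R * b.+1%:R * v) * (c * (1 + p%:R * (2 * b + 1)%N%:R * v)))).
  rewrite -[b.+1]addn1 !(natrD _ _ 1) natrM.
  have -> : (1 - p%:R * b%:R * v) * (c * (1 + p%:R * (2 * b%:R) * v)) -
    (1 - p%:R * (b%:R + 1) * v) * (c * (1 + p%:R * (2 * b%:R + 1) * v)) =
    p%:R ^+ 2 * (c * (v * v * (3 * b%:R + 1))) by ring.
  apply: pdMr => //; first exact: pd_p2.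
  apply: pdMl => //; apply: pdMl => //; first exact: pdMl.
  by apply: pdD => //; [apply: pdMl => //; apply: (pd_nat p_pr 3) | apply: pd1].
rewrite -mulrBr; apply: pdMl => //; last exact: pd_sym.
by apply: pdB => //; [apply: pd1 | apply: pdMl => //; apply: pdMl].
Qed.

Lemma gprod_first_order a b : (a <= m)%N ->
  pd 2 (G (a + p * b) - alpha a * (1 + p%:R * (b%:R * (2 * hdiff a - hdiff m)))).
Proof.
move=> le; rewrite gprod_psi //.
have h0 := psi_first_order (2 * b) le; have h1 := gprod_mulp b.
have hv := pd_hdiff (leqnn m); have hu := pd_hdiff le; have ha := pd_alpha a.
have hg := pd_gprod p_pr (p * b).
have hpn : pd 0 p%:R by apply: pd_nat.
have nat_b : pd 0 b%:R by apply: pd_nat.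
have nat_2 : pd 0 2 by apply: (pd_nat p_pr 2).
rewrite natrM in h0.
set v := hdiff m in h1 hv *; set u := hdiff a in h0 hu *; set c := alpha a in h0 ha *.
apply: (pd_trans p_pr (y := (1 - p%:R * b%:R * v) * (c * (1 + p%:R * (2 * b%:R) * u)))).
  apply: pdM_cong => //; apply: pdMl => //; apply: pdD => //; first exact: pd1.
  by apply: pdMl => //; apply: pdMl => //; apply: pdMl.
have -> : (1 - p%:R * b%:R * v) * (c * (1 + p%:R * (2 * b%:R) * u)) -
  c * (1 + p%:R * (b%:R * (2 * u - v))) =
  p%:R ^+ 2 * (- (2 * (c * (b%:R * b%:R * (u * v))))) by ring.
apply: pdMr => //; first exact: pd_p2.
apply: pdN => //; apply: pdMl => //; apply: pdMl => //.
by apply: pdMl => //; apply: pdMl.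
Qed.

Lemma pd_exp_first_order x n : pd 0 x ->
  pd 2 ((1 + p%:R * x) ^+ n - (1 + p%:R * (n%:R * x))).
Proof.
move=> hx; have hpn : pd 0 p%:R by apply: pd_nat.
elim: n => [|n IH]; first by rewrite expr0 mul0r mulr0 addr0 subrr; apply: pd0.
have -> : (1 + p%:R * x) ^+ n.+1 - (1 + p%:R * (n.+1%:R * x)) =
  (1 + p%:R * x) * ((1 + p%:R * x) ^+ n - (1 + p%:R * (n%:R * x)))
   + p%:R ^+ 2 * (n%:R * (x * x)) by rewrite exprS -[n.+1]addn1 natrD; ring.
apply: pdD => //.
  by apply: pdMl => //; apply: pdD => //; [apply: pd1 | apply: pdMl].
apply: pdMr => //; first exact: pd_p2.
by apply: pdMl => //; [apply: pd_nat | apply: pdMl].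
Qed.

(** * The reflection [a |-> m - a] modulo [p] *)

(** Reversing the numerator pairs each odd factor with an even factor such that the two add up to
    [p]; each quotient is then [-1] modulo [p]. *)
Lemma alpha_half : pd 1 (alpha m - (-1) ^+ m).
Proof.
have hp := p_half p_pr p_odd.
pose D : rat := \prod_(i < m) (2 * i + 2)%N%:R.
have hD r : (r < m)%N -> ~~ (p %| 2 * r + 2)%N by move=> lt; rewrite gtnNdvd //; lia.
have D0 : D != 0 by apply/prodf_neq0 => -[r lt] _; apply/(@ndvd_neq0 p)/hD.
have DV : pd 0 D^-1.
  by rewrite /D -prodfV; apply: pd_prod => // -[r lt] _; apply/pd_invn/hD.
apply: (pd_mulr_unit p_pr D0 DV).
have -> : (-1) ^+ m = \prod_(i < m) (-1) :> rat by rewrite prodr_const card_ord.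
rewrite mulrBl alphaE -big_split /=.
rewrite (reindex_inj rev_ord_inj) /=; apply: pd_prod_cong => // -[r lt] _ /=.
split; first exact: pd_nat.
  by rewrite mulN1r; apply/pdN/pd_nat.
rewrite mulN1r opprK -natrD; apply: pd_dvd => //.
have -> : (2 * (m - r.+1) + 1 + (2 * r + 2) = p)%N by lia.
by rewrite expn1.
Qed.

Lemma natr_reflect a : (a < m)%N ->
  (2 * (m - a.+1) + 1)%N%:R = p%:R - (2 * a + 2)%N%:R :> rat /\
  (2 * (m - a.+1) + 2)%N%:R = p%:R - (2 * a + 1)%N%:R :> rat.
Proof.
move=> lt; have hp := p_half p_pr p_odd.
by split; rewrite -natrB; try lia; congr _%:R; lia.
Qed.

(** Induction from [alpha_half]: by [natr_reflect], lowering [m - a] by one and raising [a] by one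
    multiply [alpha] by congruent ratios. *)
Lemma alpha_reflect a : (a <= m)%N -> pd 1 (alpha (m - a) - (-1) ^+ m * alpha a).
Proof.
have hp := p_half p_pr p_odd.
elim: a => [|a IH] le; first by rewrite subn0 alpha0 mulr1; apply: alpha_half.
have {}IH := IH (ltnW le).
have e : (m - a = (m - a.+1).+1)%N by lia.
rewrite e alphaS in IH.
have nX : ~~ (p %| 2 * (m - a.+1) + 1)%N by rewrite gtnNdvd //; lia.
have nY : ~~ (p %| 2 * (m - a.+1) + 2)%N by rewrite gtnNdvd //; lia.
have nZ : ~~ (p %| 2 * a + 2)%N by rewrite gtnNdvd //; lia.
have X0 := ndvd_neq0 nX; have Y0 := ndvd_neq0 nY; have Z0 := ndvd_neq0 nZ.
apply: (pd_mulr_unit p_pr X0 (pd_invn nX)).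
have [eX eY] := natr_reflect le.
have hY : pd 0 (2 * (m - a.+1) + 2)%N%:R by apply: pd_nat.
have /(pdMr p_pr)/(_ hY) := IH.
rewrite alphaS.
have hW : pd 0 (2 * a + 1)%N%:R by apply: pd_nat.
have hZ := pd_invn nZ; have ha := pd_alpha a.
have hs : pd 0 ((-1) ^+ m) by apply: pdX => //; apply: pdN; apply: pd1.
rewrite mulrBl mulrA divfK //; rewrite eX eY in Y0 X0 *.
set A := alpha (_ - _); set s := (-1) ^+ m in hs *.
set Z := (2 * a + 2)%N%:R in Z0 hZ *; set W := (2 * a + 1)%N%:R in hW *.
set c := alpha a in ha * => h; clearbody Z W.
have -> : (A - s * (c * (W / Z))) * (p%:R - Z) =
  A * (p%:R - Z) - s * c * (p%:R - W) + p%:R * (s * (c * (1 - W / Z))).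
  by field.
apply: pdD => //; apply: pdMr => //; first exact: pd_p.
apply: pdMl => //; apply: pdMl => //; apply: pdB => //; first exact: pd1.
exact: pdMl.
Qed.

(** Modulo [p] the summands of [hdiff m] at [r] and at [m - 1 - r] agree, so its last [a] summands
    add up to [hdiff a]. *)
Lemma hdiff_reflect a : (a <= m)%N -> pd 1 (hdiff (m - a) + hdiff a - hdiff m).
Proof.
have hp := p_half p_pr p_odd.
elim: a => [|a IH] le; first by rewrite subn0 /hdiff big_ord0 addr0 subrr; apply: pd0.
have {}IH := IH (ltnW le).
have e : (m - a = (m - a.+1).+1)%N by lia.
have eS n : hdiff n.+1 = hdiff n + ((2 * n + 1)%N%:R^-1 - (2 * n + 2)%N%:R^-1).
  by rewrite /hdiff big_ord_recr.
rewrite e eS in IH; rewrite eS.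
have nX : ~~ (p %| 2 * (m - a.+1) + 1)%N by rewrite gtnNdvd //; lia.
have nY : ~~ (p %| 2 * (m - a.+1) + 2)%N by rewrite gtnNdvd //; lia.
have nZ : ~~ (p %| 2 * a + 2)%N by rewrite gtnNdvd //; lia.
have nW : ~~ (p %| 2 * a + 1)%N by rewrite gtnNdvd //; lia.
have X0 := ndvd_neq0 nX; have Y0 := ndvd_neq0 nY; have Z0 := ndvd_neq0 nZ.
have W0 := ndvd_neq0 nW.
have hX := pd_invn nX; have hY := pd_invn nY; have hZ := pd_invn nZ; have hW := pd_invn nW.
have [eX eY] := natr_reflect le.
rewrite eX eY in X0 Y0 hX hY IH.
move: X0 Y0 Z0 W0 hX hY hZ hW IH.
move: (2 * a + 2)%N%:R (2 * a + 1)%N%:R (hdiff (_ - _)) (hdiff a) (hdiff m) => Z W A B C.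
move=> X0 Y0 Z0 W0 hX hY hZ hW IH.
have -> : A + (B + (W^-1 - Z^-1)) - C = A + ((p%:R - Z)^-1 - (p%:R - W)^-1) + B - C
  + p%:R * ((p%:R - W)^-1 * W^-1 - (p%:R - Z)^-1 * Z^-1).
  by field; rewrite X0 Y0 Z0 W0.
apply: pdD => //; apply: pdMr => //; first exact: pd_p.
by apply: pdB => //; apply: pdMl.
Qed.

End FirstOrder.

(** * Dwork congruences *)

Section DworkRatio.
Variables d p : nat.
Hypothesis d_ge2 : (2 <= d)%N.
Hypothesis p_pr : prime p.
Hypothesis p_odd : odd p.
Local Notation pd := (pdiv_by p).
Local Notation m := (p./2).
Local Notation z := (eps d p).

Lemma epsE : z = (-1) ^+ (d * m).
Proof. by rewrite /eps divn2; congr (_ ^+ (_ * _)); have := p_half p_pr p_odd; lia. Qed.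

Lemma eps_sqr : z * z = 1.
Proof. by rewrite epsE -expr2 sqrr_sign. Qed.

Lemma eps_expp b : z ^+ (p * b) = z ^+ b.
Proof.
have: z ^+ (2 * m + 1) = z.
  by rewrite addn1 exprS exprM expr2 eps_sqr expr1n mulr1.
by rewrite -p_half // exprM => ->.
Qed.

Lemma pd_eps n : pd 0 (z ^+ n).
Proof. by rewrite epsE -exprM; apply: pdX => //; apply/pdN/pd1. Qed.

Definition digit_ratio a b : rat :=
  gprod p (a + p * b) * (if (m < a)%N then (p * (2 * b + 1))%N%:R else 1).

Definition weight a b : rat := z ^+ a * digit_ratio a b ^+ d.

Lemma pd_digit_ratio a b : pd 0 (digit_ratio a b).
Proof.
apply: pdMl => //; first exact: pd_gprod.
by case: ifP => _; [apply: pd_nat | apply: pd1].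
Qed.

Lemma pd_weight a b : pd 0 (weight a b).
Proof. by apply: pdMl => //; [apply: pd_eps | apply: pdX => //; apply: pd_digit_ratio]. Qed.

(** The argument [b] enters only through [p * b], which gains one power of [p]. *)
Lemma weight_cong a b b' j : b = b' %[mod p ^ j] -> pd j.+1 (weight a b - weight a b').
Proof.
move=> e; rewrite -mulrBr; apply: pdMl => //; first exact: pd_eps.
apply: pdX_cong => //; try exact: pd_digit_ratio.
have ep : (p * b = p * b' %[mod p ^ j.+1])%N by rewrite expnS -!muln_modr e.
apply: pdM_cong => //; first exact: pd_gprod.
- by case: ifP => _; [apply: pd_nat | apply: pd1].
- by apply: gprod_cong => //; apply/eqP; rewrite eqn_modDl ep.
case: ifP => _; last by rewrite subrr; apply: pd0.
have pE x : (p * (2 * x + 1) = 2 * (p * x) + p)%N by lia.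
apply: pd_nat_cong => //; apply/eqP; rewrite !pE eqn_modDr.
by rewrite -modnMmr ep modnMmr.
Qed.

Definition term n : rat := alpha n ^+ d * z ^+ n.

Lemma term_digit a b : (a < p)%N -> term (a + p * b) = weight a b * term b.
Proof.
move=> lt; rewrite /term (alpha_digit p_pr p_odd b lt) exprMn exprD eps_expp /weight.
by rewrite /digit_ratio; ring.
Qed.

Lemma Ftrunc_transfer s : Ftrunc d (p ^ s) z = transfer_iter p weight s.
Proof.
apply: (sum_transfer (B := term)) => //; last exact: term_digit.
by rewrite /term alpha0 expr1n mulr1.
Qed.

(** * The digit sums modulo [p ^ 2] *)

Lemma weight_first_order a b : (a <= m)%N ->
  pd 2 (weight a b - z ^+ a * (alpha a ^+ d *
     (1 + p%:R * (d%:R * (b%:R * (2 * hdiff a - hdiff m)))))).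
Proof.
move=> le; rewrite -mulrBr; apply: pdMl => //; first exact: pd_eps.
rewrite /digit_ratio ltnNge le mulr1.
have h := gprod_first_order p_pr p_odd b le.
have ha := pd_alpha p_pr p_odd a.
have nat_b : pd 0 b%:R by apply: pd_nat.
have hx : pd 0 (b%:R * (2 * hdiff a - hdiff m)).
  apply: pdMl => //; apply: pdB => //; last exact: pd_hdiff.
  by apply: pdMl => //; [apply: (pd_nat p_pr 2) | apply: pd_hdiff].
move: (b%:R * _) h hx => x h hx.
apply: (pd_trans p_pr (y := (alpha a * (1 + p%:R * x)) ^+ d)).
  apply: pdX_cong => //; first exact: pd_gprod.
  apply: pdMl => //; apply: pdD => //; first exact: pd1.
  by apply: pdMl => //; apply: pd_nat.
rewrite exprMn -mulrBr; apply: pdMl => //; first exact: pdX.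
exact: pd_exp_first_order.
Qed.

Lemma weight_upper a b : (m < a)%N -> pd 2 (weight a b).
Proof.
move=> lt; apply: pdMl => //; first exact: pd_eps.
rewrite -(subnKC d_ge2) exprD; apply: pdMr => //; last first.
  by apply: pdX => //; apply: pd_digit_ratio.
have h : pd 1 (digit_ratio a b).
  rewrite /digit_ratio lt; apply: pdMl => //; first exact: pd_gprod.
  by apply: pd_dvd => //; rewrite expn1 dvdn_mulr.
by rewrite expr2; apply: (@pdM _ p_pr 1 1).
Qed.

Lemma first_order_antisym a : (a <= m)%N ->
  pd 1 (z ^+ (m - a) * alpha (m - a) ^+ d * (2 * hdiff (m - a) - hdiff m) +
        z ^+ a * alpha a ^+ d * (2 * hdiff a - hdiff m)).
Proof.
move=> le.
have ha := alpha_reflect p_pr p_odd le; have hv := hdiff_reflect p_pr p_odd le.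
have hs : pd 0 ((-1) ^+ m) by apply: pdX => //; apply/pdN/pd1.
have al n := pd_alpha p_pr p_odd n.
have h2 : pd 0 2 by apply: (pd_nat p_pr 2).
(* Since [z] is a sign equal to [((-1) ^+ m) ^+ d], this amounts to [z ^+ m.+1 = 1], which holds
   because [d m (m + 1)] is even. *)
have ez : z ^+ (m - a) * ((-1) ^+ m) ^+ d = z ^+ a.
  have -> : ((-1) ^+ m) ^+ d = z by rewrite epsE -exprM mulnC.
  apply: (mulIf (_ : z ^+ a != 0)).
    by rewrite expf_neq0 // epsE signr_eq0.
  rewrite mulrAC -exprD subnK // -exprD addnn -exprSr.
  rewrite -mul2n exprM expr2 eps_sqr expr1n epsE -exprM -signr_odd.
  by rewrite oddM oddM /= -andbA andbN andbF.
have hd : pd 1 (alpha (m - a) ^+ d - ((-1) ^+ m) ^+ d * alpha a ^+ d).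
  by rewrite -exprMn; apply: pdX_cong => //; apply: pdMl.
have -> : z ^+ (m - a) * alpha (m - a) ^+ d * (2 * hdiff (m - a) - hdiff m) +
   z ^+ a * alpha a ^+ d * (2 * hdiff a - hdiff m) =
   z ^+ (m - a) * ((alpha (m - a) ^+ d - ((-1) ^+ m) ^+ d * alpha a ^+ d) *
       (2 * hdiff (m - a) - hdiff m)) +
   z ^+ a * (alpha a ^+ d * (2 * (hdiff (m - a) + hdiff a - hdiff m))).
  by rewrite -ez; ring.
apply: pdD => //; apply: pdMl => //; try exact: pd_eps.
  apply: pdMr => //; apply: pdB => //; last exact: pd_hdiff.
  by apply: pdMl => //; apply: pd_hdiff => //; apply: leq_subr.
by apply: pdMl => //; [apply: pdX | apply: pdMl].
Qed.

(** Adding the sum to its reflection cancels it modulo [p] term by term; the resulting factor [2] is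
    a unit because [p] is odd. *)
Lemma first_order_sum :
  pd 1 (\sum_(a < m.+1) z ^+ a * alpha a ^+ d * (2 * hdiff a - hdiff m)).
Proof.
set T := (X in pd 1 X).
have n2 : ~~ (p %| 2)%N.
  by rewrite gtnNdvd //; have := m_gt0 p_pr p_odd; have := p_half p_pr p_odd; lia.
apply: (pd_mulr_unit p_pr (ndvd_neq0 n2) (pd_invn n2)).
have -> : T * 2%:R = T + T by rewrite mulr_natr mulr2n.
rewrite {1}/T (reindex_inj rev_ord_inj) /= -big_split /=.
apply: pd_sum => // -[a lt] _ /=; rewrite subSS.
exact: first_order_antisym.
Qed.

Lemma weight_sum_cong b : pd 2 (\sum_(a < p) weight a b - \sum_(a < p) weight a 0).
Proof.
have hp := p_half p_pr p_odd.
pose c a : rat := z ^+ a * alpha a ^+ d * (2 * hdiff a - hdiff m).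
rewrite -sumrB -(big_mkord xpredT (fun a => weight a b - weight a 0)).
rewrite (big_cat_nat (n := m.+1)) //=; last by lia.
apply: pdD => //; last first.
  rewrite big_nat; apply: pd_sum => // a /andP[lt _].
  by apply: pdB => //; apply: weight_upper.
rewrite big_mkord.
(* This is the total first-order term, small by [first_order_sum]; subtracting it leaves only the
   errors of the individual digits. *)
have h : pd 2 (p%:R * (d%:R * b%:R * \sum_(a < m.+1) c a)).
  apply: (@pdM _ p_pr 1 1); first exact: pd_p.
  by rewrite -natrM; apply: pdMl => //; [apply: pd_nat | apply: first_order_sum].
rewrite -[X in pd 2 X](subrK (p%:R * (d%:R * b%:R * \sum_(a < m.+1) c a))).
apply: pdD => //; rewrite !mulr_sumr -sumrB; apply: pd_sum => // -[a lt] _ /=.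
have hb := weight_first_order b lt; have h0 := weight_first_order 0 lt.
rewrite mul0r mulr0 mulr0 addr0 mulr1 in h0.
have -> : weight a b - weight a 0 - p%:R * (d%:R * b%:R * c a) =
  (weight a b - z ^+ a * (alpha a ^+ d *
     (1 + p%:R * (d%:R * (b%:R * (2 * hdiff a - hdiff m)))))) -
  (weight a 0 - z ^+ a * alpha a ^+ d) by rewrite /c; ring.
exact: pdB.
Qed.

(** * Dwork's congruences and the convergence of the ratios *)

Lemma Ftrunc_dwork s : pd s.+1
  (Ftrunc d (p ^ s.+2) z * Ftrunc d (p ^ s) z - Ftrunc d (p ^ s.+1) z ^+ 2).
Proof.
rewrite !Ftrunc_transfer; apply: transfer_dwork => //.
- by move=> a b _; apply: pd_weight.
- by move=> a b b' j _; apply: weight_cong.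
Qed.

Lemma Ftrunc_p2_cong : pd 2 (Ftrunc d (p ^ 2) z - Ftrunc d (p ^ 1) z ^+ 2).
Proof.
rewrite !Ftrunc_transfer; apply: transfer_iter2_cong => //.
- by move=> a b _; apply: pd_weight.
- exact: weight_sum_cong.
Qed.

Lemma Ftrunc_int s : pd 0 (Ftrunc d (p ^ s) z).
Proof.
by rewrite Ftrunc_transfer; apply: transfer_iter_int => // a b _; apply: pd_weight.
Qed.

Hypothesis F_unit : padic_unit p (Ftrunc d p z).

Lemma Ftrunc_unit s : padic_unit p (Ftrunc d (p ^ s) z).
Proof.
have [k] := ubnP s; elim: k s => // k IH [|[|s]] lt.
- by rewrite Ftrunc_transfer /padic_unit oner_neq0 /vp subrr.
- by rewrite expn1.
(* Modulo [p] the product of the outer two truncations is the square of the middle one, a unit by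
   induction; a p-integral factor of a unit is a unit. *)
apply: (padic_unit_divr p_pr (Ftrunc_int s.+2) (Ftrunc_int s)).
have u1 : padic_unit p (Ftrunc d (p ^ s.+1) z) by apply: IH; lia.
apply: padic_unit_cong (padic_unitM p_pr u1 u1) _ => //.
by apply: pd_sym; rewrite -expr2; apply: pd_le (Ftrunc_dwork s).
Qed.

Lemma Fratio_succ s : pd s.+1 (Fratio d p s.+2 z - Fratio d p s.+1 z).
Proof.
have [n0 i0] := pd_unitV p_pr (Ftrunc_unit s).
have [n1 i1] := pd_unitV p_pr (Ftrunc_unit s.+1).
have := Ftrunc_dwork s; rewrite /Fratio /=.
set x := Ftrunc d (p ^ s) z in n0 i0 *; set y := Ftrunc d (p ^ s.+1) z in n1 i1 *.
set t := Ftrunc _ _ _ => h.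
have -> : t / y - y / x = (t * x - y ^+ 2) * (x^-1 * y^-1).
  by field; rewrite n0 n1.
by apply: pdMr => //; apply: pdMl.
Qed.

Lemma Fratio_cauchy N s : (N < s)%N -> pd N.+1 (Fratio d p s z - Fratio d p N.+1 z).
Proof.
elim: s => // s IH; rewrite ltnS leq_eqVlt => /orP[/eqP ->|lt].
  by rewrite subrr; apply: pd0.
apply: pd_trans (IH lt) => //.
by case: s lt {IH} => // s lt; apply: pd_le (Fratio_succ s).
Qed.

End DworkRatio.

Theorem theorem1p1 (d p : nat) :
  (2 <= d)%N -> prime p -> odd p ->
  padic_unit p (Ftrunc d p (eps d p)) ->
  [/\ (forall s : nat, (1 <= s)%N -> padic_unit p (Ftrunc d (p ^ s) (eps d p))),
      (* the sequence of ratios is p-adically Cauchy, i.e. converges in Z_p *)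
      (forall k : nat, exists N : nat, forall s t : nat, (N <= s)%N -> (N <= t)%N ->
         pcong p k (Fratio d p s (eps d p)) (Fratio d p t (eps d p)))
    & (* F_p(eps) = f(eps) mod p^2, f the limit *)
      (exists N : nat, forall s : nat, (N <= s)%N ->
         pcong p 2 (Fratio d p s (eps d p)) (Ftrunc d p (eps d p)))].
Proof.
move=> d2 p_pr p_odd F_unit; split=> [s _|k|].
- exact: Ftrunc_unit.
- exists k.+1 => s t les let_; apply: pcong_pd => //; apply: (@pd_le p _ k.+1) => //.
  apply: (pd_trans p_pr (y := Fratio d p k.+1 (eps d p))).
    exact: Fratio_cauchy.
  by apply: pd_sym; apply: Fratio_cauchy.
(* From index [2] on, all ratios agree modulo [p ^ 2] with the one at [2], which is [F_{p^2} / F_p]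
   and is compared with [F_p] by [Ftrunc_p2_cong]. *)
exists 2%N => s les; apply: pcong_pd => //.
apply: (pd_trans p_pr (y := Fratio d p 2 (eps d p))); first exact: Fratio_cauchy.
have [n1 i1] := pd_unitV p_pr F_unit.
have := Ftrunc_p2_cong d2 p_pr p_odd; rewrite /Fratio /= expn1 => h.
set x := Ftrunc d p _ in n1 i1 h *; set y := Ftrunc _ _ _ in h *.
have -> : y / x - x = (y - x ^+ 2) * x^-1 by field.
exact: pdMr.
Qed.
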